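(* Suppose $\mathbf{X}^*$ is an optimal solution to the convex problem $\min_{\mathbf{X}\in\mathcal{F}_{n,k}} f(\mathbf{X})$ satisfying, for some $\delta>0$, the eigen-gap assumption $\lambda_{n-k}(\nabla f(\mathbf{X}^* ))-\lambda_{n-k+1}(\nabla f(\mathbf{X}^* ))\ge\delta$. Let $\{\mathbf{X}_t\}_{t\ge1}$ be a sequence with $\mathbf{X}_1\in\mathcal{F}_{n,k}$, $\|\mathbf{X}_1-\mathbf{X}^*\|_F\le\frac{\delta}{4\beta}$, and $\mathbf{X}_{t+1}=\Pi_{\mathcal{P}_{n,k}}[\mathbf{X}_t-\eta\nabla f(\mathbf{X}_t)]$ for all $t\ge1$ with $\eta=1/\beta$. Then for all $t\ge1$: 1. $\mathrm{rank}(\mathbf{X}_{t+1})=k$, and thus, given $\mathbf{X}_t$ and $\nabla f(\mathbf{X}_t)$, $\mathbf{X}_{t+1}$ can be computed via a rank-$k$ SVD (i.e. from $k$ leading eigenvectors of $\mathbf{X}_t-\eta\nabla f(\mathbf{X}_t)$); 2. $f(\mathbf{X}_t)-f(\mathbf{X}^* )\le\big(f(\mathbf{X}_1)-f(\mathbf{X}^* )\big)\exp\big(-\Theta(\delta/\beta)(t-1)\big)$.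
   Context: Let $1\le k<n$ be integers. $\mathbb{S}^n$ is the space of real symmetric $n\times n$ matrices with inner product $\langle \mathbf{A},\mathbf{B}\rangle=\mathrm{Tr}(\mathbf{A}\mathbf{B})$; $\|\cdot\|_F$ is the Frobenius norm; $\lambda_i(\mathbf{A})$ is the $i$-th largest eigenvalue of $\mathbf{A}\in\mathbb{S}^n$. $\mathcal{P}_{n,k}=\{\mathbf{Q}\mathbf{Q}^\top : \mathbf{Q}\in\mathbb{R}^{n\times k},\ \mathbf{Q}^\top\mathbf{Q}=\mathbf{I}\}$, and the Fantope is $\mathcal{F}_{n,k}=\mathrm{conv}(\mathcal{P}_{n,k})=\{\mathbf{X}\in\mathbb{S}^n : \mathbf{I}\succeq\mathbf{X}\succeq0,\ \mathrm{Tr}(\mathbf{X})=k\}$. $\Pi_{\mathcal{P}_{n,k}}[\mathbf{Y}]$ denotes a Euclidean (Frobenius) projection of $\mathbf{Y}$ onto $\mathcal{P}_{n,k}$, i.e. a nearest point (in general not unique since the set is nonconvex); it is given by the projection matrix onto a span of $k$ leading eigenvectors of $\mathbf{Y}$. $f:\mathbb{S}^n\to\mathbb{R}$ is convex, differentiable and $\beta$-smooth, $\beta>0$: $\|\nabla f(\mathbf{X})-\nabla f(\mathbf{Y})\|_F\le\beta\|\mathbf{X}-\mathbf{Y}\|_F$ for all $\mathbf{X},\mathbf{Y}$. $\Theta(\delta/\beta)$ is asymptotic notation: it stands for $\rho(\delta/\beta)$, where $\rho:(0,\infty)\to(0,\infty)$ is a universal function (independent of $n,k,f,t$ and the sequence)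 with $\rho(x)=\Theta(x)$ as $x\to0^+$. *)

(* Defs.v *)
From mathcomp Require Import all_boot all_order all_algebra.
From mathcomp Require Import spectral complex.
From mathcomp Require Import all_classical all_reals all_analysis.
Set Implicit Arguments.
Unset Strict Implicit.
Unset Printing Implicit Defensive.
Import Order.TTheory GRing.Theory Num.Theory.
Import numFieldNormedType.Exports.
Local Open Scope classical_set_scope.
Local Open Scope ring_scope.

(* Functions on the space of symmetric matrices are represented by total
   functions on 'M[R]_n whose hypotheses only concern symmetric arguments;
   values elsewhere are irrelevant. *)

Definition symm (R : realType) (n : nat) : set 'M[R]_n := [set A | A^T = A].

(* The library norm `|A| on matrices is the sup norm, hence a separate
   Frobenius norm; both induce the same topology. *)
Definition frob (R : realType) (m n : nat) (A : 'M[R]_(m, n)) : R :=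
  Num.sqrt (\sum_i \sum_j A i j ^+ 2).

Definition inner (R : realType) (n : nat) (A B : 'M[R]_n) : R := \tr (A *m B).

(* The nonincreasing list of the roots of the characteristic polynomial, with
   multiplicity; [eigvalsP] shows that it exists for every symmetric matrix. *)
Definition eigvals (R : realType) (n : nat) (A : 'M[R]_n) : seq R :=
  xget [::] [set s : seq R | sorted (fun x y => y <= x) s /\
                             char_poly A = \prod_(a <- s) ('X - a%:P)].

(* The i-th largest eigenvalue, counted from i = 1. *)
Definition lambda (R : realType) (n : nat) (i : nat) (A : 'M[R]_n) : R :=
  nth 0 (eigvals A) i.-1.

Lemma eigvalsP (R : realType) (n : nat) (A : 'M[R]_n) : symm A ->
  sorted (fun x y => y <= x) (eigvals A) /\
  char_poly A = \prod_(a <- eigvals A) ('X - a%:P).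
Proof.
move=> symA; rewrite /eigvals; case: xgetP => [s _ []//|noS].
pose f := real_complex R; pose B := map_mx f A.
have symB : B^T = B by rewrite /B map_trmx symA.
have hB : B \is hermsymmx.
  apply: realsym_hermsym.
    by apply/is_hermitianmxP; rewrite expr0 scale1r map_mx_id ?symB.
  by apply/mxOverP => i j; rewrite mxE complex_real.
have /orthomx_spectralP := hermitian_normalmx hB.
have /mxOverP/(_ 0) := hermitian_spectral_diag_real hB.
have := spectral_unit B.
set d := spectral_diag B; set P := spectralmx B => Pu dreal eqB.
have cB : char_poly B = \prod_i ('X - (d 0 i)%:P).
  have -> : char_poly B = char_poly (diag_mx d).
    have Q1 : map_mx polyC (invmx P) *m map_mx polyC P = 1%:M.
      by rewrite -map_mxM mulVmx // map_mx1.
    rewrite /char_poly /char_poly_mx {1}eqB !map_mxM /=.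
    have eX : 'X%:M = map_mx polyC (invmx P) *m 'X%:M *m map_mx polyC P.
      by rewrite mul_mx_scalar -scalemxAl Q1 scalemx1.
    rewrite {1}eX -mulmxBl -mulmxBr !det_mulmx mulrAC -det_mulmx.
    by rewrite Q1 det1 mul1r.
  rewrite char_poly_trig ?diag_mx_is_trig //.
  by apply: eq_bigr => i _; rewrite mxE eqxx mulr1n.
pose s := sort (fun x y : R => y <= x) [seq complex.Re (d 0 i) | i <- enum 'I_n].
case: (noS s); split; first by apply: sort_sorted => x y; exact: le_total.
apply: (map_poly_inj f).
rewrite map_char_poly -/B cB rmorph_prod /= (perm_big _ (permEl (perm_sort _ _))).
rewrite /= big_map big_enum; apply: eq_bigr => i _.
by rewrite map_polyXsubC -[in LHS](RRe_real (dreal i)).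
Qed.

(* Frechet differentiability on the space of symmetric matrices: increments are
   restricted to symmetric H, and G represents the differential for [inner]. *)
Definition is_gradient (R : realType) (n : nat)
    (f : 'M[R]_n -> R) (X G : 'M[R]_n) : Prop :=
  symm G /\
  (f (X + H) - f X - inner G H) / frob H
    @[H --> within (@symm R n) ((0 : 'M[R]_n)^')] --> (0 : R).

Definition orthoproj (R : realType) (n k : nat) : set 'M[R]_n :=
  [set X | exists Q : 'M[R]_(n, k), Q^T *m Q = 1%:M /\ X = Q *m Q^T].

Definition conv_hull (R : realType) (E : lmodType R) (S : set E) : set E :=
  [set x | exists (m : nat) (w : 'I_m -> R) (p : 'I_m -> E),
     [/\ forall i, 0 <= w i, \sum_i w i = 1, forall i, S (p i)
       & x = \sum_i w i *: p i]].

Definition fantope (R : realType) (n k : nat) : set 'M[R]_n :=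
  conv_hull (@orthoproj R n k).

Definition is_projection (R : realType) (n : nat) (S : set 'M[R]_n)
    (Y Z : 'M[R]_n) : Prop :=
  S Z /\ forall W, S W -> frob (Y - Z) <= frob (Y - W).

Definition leading_eigenvectors (R : realType) (n k : nat)
    (Y : 'M[R]_n) (Q : 'M[R]_(n, k)) : Prop :=
  Q^T *m Q = 1%:M /\
  forall j : 'I_k, Y *m col j Q = lambda j.+1 Y *: col j Q.

(* Main.v *)
(* The eigengap makes [Xs] the orthogonal projection onto the bottom [k]-space
   of the gradient and gives [f] quadratic growth
   [f Z - f Xs >= delta / 2 * |Z - Xs|^2] on the Fantope. By Weyl's inequality,
   [X - gradf X / beta] has gap at least [1] between its [k]-th and [k+1]-st
   eigenvalues when [|X - Xs| <= delta / (4 beta)], so its projection onto the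
   nonconvex set of orthogonal projections is unique and coincides with its
   projection onto the Fantope. The iterates are thus those of the projected
   gradient method over a convex set: they never move away from [Xs], and
   quadratic growth makes the objective gap contract geometrically. *)

Require Import Defs.
From mathcomp Require Import all_boot all_order all_algebra.
From mathcomp Require Import all_classical all_reals all_analysis.
From mathcomp Require Import zify ring lra.
Import Order.TTheory GRing.Theory Num.Theory.
Import numFieldNormedType.Exports.
Local Open Scope classical_set_scope.
Local Open Scope ring_scope.

Set Implicit Arguments.
Unset Strict Implicit.
Unset Printing Implicit Defensive.

(** * Trace inner product and Frobenius norm *)

Section Inner.
Variables (R : realType) (n : nat).
Implicit Types A B C : 'M[R]_n.

Lemma innerC A B : inner A B = inner B A.
Proof. exact: mxtrace_mulC. Qed.

Lemma innerDl A B C : inner (A + B) C = inner A C + inner B C.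
Proof. by rewrite /inner mulmxDl mxtraceD. Qed.

Lemma innerNl A B : inner (- A) B = - inner A B.
Proof. by rewrite /inner mulNmx raddfN. Qed.

Lemma innerZl a A B : inner (a *: A) B = a * inner A B.
Proof. by rewrite /inner -scalemxAl mxtraceZ. Qed.

Lemma innerDr A B C : inner A (B + C) = inner A B + inner A C.
Proof. by rewrite /inner mulmxDr mxtraceD. Qed.

Lemma innerNr A B : inner A (- B) = - inner A B.
Proof. by rewrite innerC innerNl innerC. Qed.

Lemma innerZr a A B : inner A (a *: B) = a * inner A B.
Proof. by rewrite innerC innerZl innerC. Qed.

Definition innerE := (innerDl, innerDr, innerNl, innerNr, innerZl, innerZr).

Lemma symmD A B : symm A -> symm B -> symm (A + B).
Proof. by rewrite /symm /= linearD /= => -> ->. Qed.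

Lemma symmN A : symm A -> symm (- A).
Proof. by rewrite /symm /= linearN /= => ->. Qed.

Lemma symmB A B : symm A -> symm B -> symm (A - B).
Proof. by move=> sA sB; apply/symmD/symmN. Qed.

Lemma symmZ a A : symm A -> symm (a *: A).
Proof. by rewrite /symm /= linearZ /= => ->. Qed.

Lemma frob_ge0 m p (A : 'M[R]_(m, p)) : 0 <= frob A.
Proof. exact: sqrtr_ge0. Qed.

Lemma sqr_frob A : symm A -> frob A ^+ 2 = inner A A.
Proof.
rewrite /symm /= => sA.
rewrite sqr_sqrtr; last by do 2!(apply: sumr_ge0 => ? _); rewrite sqr_ge0.
apply: eq_bigr => i _; rewrite mxE; apply: eq_bigr => j _.
by rewrite expr2 -{2}sA mxE.
Qed.

Lemma frob_eq0 A : frob A = 0 -> A = 0.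
Proof.
move/eqP; rewrite sqrtr_eq0 => le0.
have ge0 i : 0 <= \sum_j A i j ^+ 2 by apply: sumr_ge0 => j _; rewrite sqr_ge0.
have /eqP : \sum_i \sum_j A i j ^+ 2 == 0 by rewrite eq_le le0 sumr_ge0.
move=> /psumr_eq0P - /(_ (fun i _ => ge0 i)) rows0.
apply/matrixP => i j; rewrite mxE; apply/eqP; rewrite -sqrf_eq0; apply/eqP.
by have /psumr_eq0P := rows0 i isT; apply => // ? _; rewrite sqr_ge0.
Qed.

Lemma frob_distC A B : frob (A - B) = frob (B - A).
Proof.
by congr Num.sqrt; apply: eq_bigr => i _; apply: eq_bigr => j _;
  rewrite !mxE -sqrrN opprB.
Qed.

Lemma frobZ a A : 0 <= a -> frob (a *: A) = a * frob A.
Proof.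
move=> a0; rewrite /frob -[in RHS](ger0_norm a0) -sqrtr_sqr -sqrtrM ?sqr_ge0//.
congr Num.sqrt; rewrite mulr_sumr; apply: eq_bigr => i _.
by rewrite mulr_sumr; apply: eq_bigr => j _; rewrite mxE exprMn.
Qed.

(** Cauchy-Schwarz, from expanding the square of [frob B *: A - frob A *: B]. Zero norms are set
    aside so that the product of the norms can be cancelled. *)
Lemma inner_le_frob A B : symm A -> symm B -> inner A B <= frob A * frob B.
Proof.
move=> sA sB; have [a0|a0] := eqVneq (frob A) 0.
  by rewrite a0 mul0r (frob_eq0 a0) /inner mul0mx mxtrace0.
have [b0|b0] := eqVneq (frob B) 0.
  by rewrite b0 mulr0 (frob_eq0 b0) /inner mulmx0 mxtrace0.
have := sqr_ge0 (frob (frob B *: A - frob A *: B)).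
rewrite sqr_frob; last by apply: symmB; apply: symmZ.
rewrite !innerE -!sqr_frob// (innerC B A).
have : 0 < frob A * frob B by rewrite mulr_gt0// lt_def ?a0 ?b0 frob_ge0.
move: (frob A) (frob B) (inner A B) => x y z xy h.
by rewrite -(ler_pM2l xy); nra.
Qed.

Lemma frob_triangle A B : symm A -> symm B -> frob (A + B) <= frob A + frob B.
Proof.
move=> sA sB; rewrite -(ler_pXn2r (ltn0Sn 1)) ?nnegrE ?addr_ge0 ?frob_ge0//.
rewrite sqr_frob ?innerE; last exact: symmD.
have := inner_le_frob sA sB; rewrite (innerC B A) sqrrD !sqr_frob//; lra.
Qed.

End Inner.

(** * Spectral theorem for real symmetric matrices *)

Section RealSpectral.
Variable R : rcfType.

Lemma col_normE m (x : 'cV[R]_m) : x^T *m x = (\sum_i x i 0 ^+ 2)%:M.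
Proof.
rewrite [LHS]mx11_scalar mxE; congr _%:M.
by apply: eq_bigr => i _; rewrite mxE expr2.
Qed.

Lemma col_norm_gt0 m (x : 'cV[R]_m) : x != 0 -> 0 < \sum_i x i 0 ^+ 2.
Proof.
move=> x0; rewrite lt_def sumr_ge0 ?andbT => [|i _]; last exact: sqr_ge0.
apply: contra x0; rewrite psumr_eq0 => [/allP x0|i _]; last exact: sqr_ge0.
apply/eqP/colP => i; rewrite mxE; apply/eqP; rewrite -sqrf_eq0.
by have /implyP := x0 i (mem_index_enum i); apply.
Qed.

(* The Householder reflection exchanging the first basis vector and [x]. *)
Lemma orthogonal_first_col m (x : 'cV[R]_(1 + m)) : x^T *m x = 1%:M ->
  exists H : 'M[R]_(1 + m), H^T *m H = 1%:M /\ col 0 H = x.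
Proof.
move=> nx; pose e : 'cV[R]_(1 + m) := delta_mx 0 0.
have ee : e^T *m e = 1%:M.
  by rewrite trmx_delta mul_delta_mx; apply/matrixP => i j; rewrite !ord1 !mxE.
pose w := e - x; have [w0|w0] := eqVneq w 0.
  exists 1%:M; rewrite trmx1 mulmx1; split=> //; apply/esym.
  have -> : x = e by apply/esym/eqP; rewrite -subr_eq0 -/w w0.
  by rewrite colE mul1mx.
set N := \sum_i w i 0 ^+ 2.
have N0 : N != 0 by apply: lt0r_neq0; apply: col_norm_gt0.
(* Both [e] and [x] have norm one, so [w] pairs with [e] to half of [N]; hence the reflection below
   sends [e] to [e - w], which is [x]. *)
have wx : w^T *m e = (N / 2)%:M.
  have wT : w^T = e^T - x^T by rewrite /w linearB.
  have [c exE] : exists c, e^T *m x = c%:M by eexists; exact: mx11_scalar.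
  have xeE : x^T *m e = c%:M by rewrite -tr_scalar_mx -exE trmx_mul trmxK.
  have : w^T *m w = N%:M := col_normE w.
  rewrite wT {1}/w mulmxBr !mulmxBl nx ee exE xeE -!raddfB => /matrixP/(_ 0 0).
  rewrite !mxE !mulr1n => <-; congr _%:M.
  by field.
pose H := 1%:M - (2 / N) *: (w *m w^T).
have HT : H^T = H.
  by rewrite /H linearB linearZ /= trmx_mul trmxK trmx1.
exists H; split; last first.
  rewrite colE -/e mulmxBl mul1mx -scalemxAl -mulmxA wx mul_mx_scalar scalerA.
  rewrite (_ : 2 / N * (N / 2) = 1); last by field.
  by rewrite scale1r /w subKr.
rewrite HT /H mulmxBl mul1mx -scalemxAl !mulmxBr mulmx1 -!scalemxAr.
rewrite -mulmxA (mulmxA w^T) col_normE -/N mul_scalar_mx -scalemxAr scalerA.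
rewrite (_ : 2 / N * N = 2); last by field.
rewrite (_ : (2 / N) *: (_ - _) = - ((2 / N) *: (w *m w^T))) ?opprK ?subrK//.
by rewrite -[RHS]scalerN scaler_nat mulr2n opprD addrA subrr add0r.
Qed.

Lemma char_poly_conj (F : fieldType) n (A H : 'M[F]_n) : H^T *m H = 1%:M ->
  char_poly (H^T *m A *m H) = char_poly A.
Proof.
move=> HH; have H1 : map_mx polyC H^T *m map_mx polyC H = 1%:M.
  by rewrite -map_mxM HH map_mx1.
rewrite /char_poly /char_poly_mx !map_mxM /=.
have eX : 'X%:M = map_mx polyC H^T *m 'X%:M *m map_mx polyC H.
  by rewrite scalar_mxC -mulmxA H1 mulmx1.
rewrite {1}eX -mulmxBl -mulmxBr !det_mulmx mulrAC -det_mulmx.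
by rewrite H1 det1 mul1r.
Qed.

(** Deflation: an eigenvector for the first root becomes the first column of an orthogonal [H], and
    the induction hypothesis diagonalizes the remaining block of [H^T *m A *m H]. The order of [s]
    is arbitrary, so eigenvalues can be listed upwards as well as downwards. *)
Lemma real_spectral n (A : 'M[R]_n) (s : seq R) : A^T = A ->
  char_poly A = \prod_(a <- s) ('X - a%:P) ->
  exists U : 'M[R]_n,
    U^T *m U = 1%:M /\ A *m U = U *m diag_mx (\row_i s`_i).
Proof.
elim: n A s => [|n IHn] A s sA cA.
  by exists 1%:M; split; apply/matrixP => -[].
case: s cA => [|a s] cA.
  by have := size_char_poly A; rewrite cA big_nil size_poly1.
have /eigenvalueP[v vA v0] : eigenvalue A a.
  by rewrite eigenvalue_root_char cA big_cons rootM root_XsubC eqxx.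
have vT0 : v^T != 0.
  by apply: contra v0 => /eqP/(congr1 trmx); rewrite trmxK trmx0 => ->.
set N := \sum_i v^T i 0 ^+ 2; have N0 : 0 < N := col_norm_gt0 vT0.
pose x : 'cV[R]_(1 + n) := (Num.sqrt N)^-1 *: v^T.
have Ax : A *m x = a *: x.
  by rewrite -scalemxAr -{1}sA -trmx_mul vA linearZ /= !scalerA mulrC.
have nx : x^T *m x = 1%:M.
  have -> : x^T = (Num.sqrt N)^-1 *: v^T^T by rewrite /x linearZ.
  rewrite -scalemxAl -scalemxAr scalerA col_normE -/N -expr2 exprVn.
  by rewrite sqr_sqrtr ?ltW// scale_scalar_mx mulVf ?gt_eqF.
have [H [HH H0]] := orthogonal_first_col nx.
have [B defB] : exists B : 'M[R]_(1 + n), B = H^T *m A *m H by eexists.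
have sB : B^T = B by rewrite defB !trmx_mul trmxK sA mulmxA.
have B0 : B *m delta_mx 0 0 = a *: (delta_mx 0 0 : 'cV_(1 + n)).
  rewrite defB -!mulmxA -colE H0 Ax -scalemxAr -H0; congr (_ *: _).
  by rewrite colE mulmxA HH mul1mx.
have l0 : lshift n (0 : 'I_1) = 0 :> 'I_(1 + n) by apply: val_inj.
have Bi i : B i (lshift n 0) = a * (i == lshift n 0)%:R.
  by have /colP/(_ i) := B0; rewrite l0 -colE !mxE andbT.
pose C := drsubmx B.
(* [H] maps the first basis vector to an eigenvector, which determines the first column of [B];
   symmetry then determines its first row. *)
have eB : B = block_mx a%:M 0 0 C.
  rewrite -[LHS]submxK; congr block_mx.
  - apply/matrixP => i j; rewrite !ord1 !mxE Bi eqxx.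
    by rewrite mulr1.
  - apply/matrixP => i j; rewrite !ord1 -sB !mxE Bi.
    by rewrite mulr0.
  - apply/matrixP => i j; rewrite !ord1 !mxE Bi.
    by rewrite mulr0.
have sC : C^T = C by rewrite /C -[in LHS]sB; apply/matrixP => i j; rewrite !mxE.
have cC : char_poly C = \prod_(b <- s) ('X - b%:P).
  apply: (mulfI (negbT (polyXsubC_eq0 a))).
  move: (cA); rewrite big_cons => <-; rewrite -(char_poly_conj A HH) -defB eB.
  rewrite /char_poly (@char_block_diag_mx _ 1 n) (@det_ublock _ 1 n); congr (_ * _).
  by rewrite [char_poly_mx _]mx11_scalar det_scalar1 !mxE eqxx.
have [W [WW CW]] := IHn C s sC cC.
pose K : 'M[R]_(1 + n) := block_mx 1%:M 0 0 W.
pose D : 'M[R]_(1 + n) := block_mx a%:M 0 0 (diag_mx (\row_i s`_i)).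
have KK : K^T *m K = 1%:M.
  rewrite tr_block_mx mulmx_block !(trmx0, trmx1, mul0mx, mulmx0, addr0, add0r).
  by rewrite mulmx1 WW -scalar_mx_block.
have BK : B *m K = K *m D.
  rewrite eB !mulmx_block !(mul0mx, mulmx0, addr0, add0r).
  by rewrite mulmx1 mul1mx CW.
have -> : diag_mx (\row_i (a :: s)`_i) = D.
  rewrite /D (_ : a%:M = diag_mx (\row_(i < 1) a)); last first.
    by apply/matrixP => i j; rewrite !mxE.
  rewrite -diag_mx_row; congr diag_mx; apply/rowP => i; rewrite !mxE.
  by case: splitP => j ->; rewrite ?ord1 mxE.
exists (H *m K); split.
  by rewrite trmx_mul -mulmxA (mulmxA H^T) HH mul1mx.
rewrite -(mulmxA H) -BK defB -!(mulmxA H^T) (mulmxA H) (mulmx1C HH) mul1mx.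
by rewrite !mulmxA.
Qed.

End RealSpectral.

(** * Convex hulls, orthogonal projections and the Fantope *)

Lemma conv_hull_segment (R : realType) (E : lmodType R) (S : set E) x y (s : R) :
  0 <= s -> s <= 1 -> conv_hull S x -> conv_hull S y ->
  conv_hull S (x + s *: (y - x)).
Proof.
move=> s0 s1 [m [w [p [w0 w1 Sp ->]]]] [m' [w' [p' [w'0 w'1 Sp' ->]]]].
exists (m + m')%N, (fun i => match fintype.split i with
  | inl j => (1 - s) * w j | inr j => s * w' j end),
  (fun i => match fintype.split i with inl j => p j | inr j => p' j end).
have splitl j : fintype.split (lshift m' j : 'I_(m + m')) = inl j := unsplitK (inl j).
have splitr j : fintype.split (rshift m j : 'I_(m + m')) = inr j := unsplitK (inr j).
split.
- by move=> i; case: fintype.split => j; rewrite mulr_ge0// subr_ge0.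
- rewrite big_split_ord /=; under eq_bigr do rewrite splitl.
  under [X in _ + X]eq_bigr do rewrite splitr.
  by rewrite -!mulr_sumr w1 w'1 !mulr1 subrK.
- by move=> i; case: fintype.split => j.
- rewrite big_split_ord /=; under [in RHS]eq_bigr do rewrite splitl -scalerA.
  under [X in _ = _ + X]eq_bigr do rewrite splitr -scalerA.
  by rewrite -!scaler_sumr scalerBl scale1r scalerBr addrA addrAC.
Qed.

Section Fantope.
Variables (R : realType) (n k : nat).
Implicit Types A P Z : 'M[R]_n.

Lemma mxtrace_mul_tr m p (M : 'M[R]_(m, p)) :
  \tr (M *m M^T) = \sum_i \sum_j M i j ^+ 2.
Proof.
apply: eq_bigr => i _; rewrite mxE; apply: eq_bigr => j _.
by rewrite mxE expr2.
Qed.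

Lemma mxtrace_mul_tr_ge0 m p (M : 'M[R]_(m, p)) : 0 <= \tr (M *m M^T).
Proof.
by rewrite mxtrace_mul_tr; do 2!(apply: sumr_ge0 => ? _); rewrite sqr_ge0.
Qed.

Lemma orthoproj_symm P : orthoproj k P -> symm P.
Proof. by move=> [Q [_ ->]]; rewrite /symm /= trmx_mul trmxK. Qed.

Lemma orthoproj_idem P : orthoproj k P -> P *m P = P.
Proof.
by move=> [Q [QQ ->]]; rewrite mulmxA -[_ *m Q^T *m Q]mulmxA QQ mulmx1.
Qed.

Lemma orthoproj_tr P : orthoproj k P -> \tr P = k%:R.
Proof. by move=> [Q [QQ ->]]; rewrite mxtrace_mulC QQ mxtrace1. Qed.

Lemma orthoproj_norm P : orthoproj k P -> inner P P = k%:R.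
Proof. by move=> PP; rewrite /inner (orthoproj_idem PP) orthoproj_tr. Qed.

Lemma orthoproj_rank P : orthoproj k P -> \rank P = k.
Proof.
move=> [Q [QQ ->]]; have rQ : (\rank Q^T = k).
  apply/eqP; rewrite eqn_leq rank_leq_row /=.
  by have := mxrankM_maxl Q^T Q; rewrite QQ mxrank1.
by rewrite mxrankMfree /row_free ?rQ// -[LHS]mxrank_tr.
Qed.

Lemma fantope_orthoproj P : orthoproj k P -> fantope k P.
Proof.
move=> PP; exists 1%N, (fun=> 1), (fun=> P); split=> //.
- by rewrite big_ord1.
- by rewrite big_ord1 scale1r.
Qed.

(** Convex combinations preserve linear bounds. The trace, quadratic-form and inner-product facts on
    the Fantope below are all reduced to projections in this way. *)
Lemma fantope_inner_le A (c : R) Z :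
  (forall P, orthoproj k P -> inner A P <= c) -> fantope k Z -> inner A Z <= c.
Proof.
move=> le_c [m [w [p [w0 w1 pP ->]]]].
rewrite /inner mulmx_sumr raddf_sum /= -[leRHS]mul1r -w1 mulr_suml.
apply: ler_sum => i _; rewrite -scalemxAr mxtraceZ ler_wpM2l//.
exact/le_c/pP.
Qed.

Lemma fantope_symm Z : fantope k Z -> symm Z.
Proof.
move=> [m [w [p [_ _ pP ->]]]]; rewrite /symm /= linear_sum /=.
by apply: eq_bigr => i _; rewrite linearZ /= (orthoproj_symm (pP i)).
Qed.

Lemma fantope_tr Z : fantope k Z -> \tr Z = k%:R.
Proof.
move=> FZ; rewrite -[Z]mul1mx -/(inner _ Z); apply/eqP; rewrite eq_le.
rewrite -[X in _ && X]lerN2 -innerNl !fantope_inner_le// => P PP.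
  by rewrite innerNl /inner mul1mx orthoproj_tr.
by rewrite /inner mul1mx orthoproj_tr.
Qed.

(** For a symmetric idempotent [S], pairing [v *m v^T] with [S] gives the squared length of
    [S *m v]. Taking [S = P] yields the lower bound and [S = 1%:M - P] the upper one. *)
Lemma orthoproj_quad (v : 'cV[R]_n) P : orthoproj k P ->
  0 <= inner (v *m v^T) P <= \tr (v *m v^T).
Proof.
move=> PP; have sP : P^T = P := orthoproj_symm PP.
have quadE S : S^T = S -> S *m S = S ->
    inner (v *m v^T) S = \tr ((S *m v) *m (S *m v)^T).
  move=> sS SS; rewrite trmx_mul sS -(mulmxA S) (mxtrace_mulC S) -!mulmxA SS.
  by rewrite /inner -mulmxA.
rewrite (quadE P) ?orthoproj_idem// mxtrace_mul_tr_ge0 /=.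
rewrite -quadE ?orthoproj_idem// -subr_ge0.
have -> : \tr (v *m v^T) - inner (v *m v^T) P = inner (v *m v^T) (1%:M - P).
  by rewrite innerDr innerNr /inner mulmx1.
rewrite quadE ?mxtrace_mul_tr_ge0//; first by rewrite linearB /= trmx1 sP.
by rewrite mulmxBl mul1mx mulmxBr mulmx1 orthoproj_idem// subrr subr0.
Qed.

Lemma fantope_quad (v : 'cV[R]_n) Z : fantope k Z ->
  0 <= inner (v *m v^T) Z <= \tr (v *m v^T).
Proof.
move=> FZ; rewrite -oppr_le0 -innerNl !fantope_inner_le//.
  by move=> P /(orthoproj_quad v)/andP[]; rewrite innerNl oppr_le0.
by move=> P /(orthoproj_quad v)/andP[].
Qed.

(** Linearity in each argument reduces the bound to two projections, each of squared norm [k], whose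
    squared distance is nonnegative. *)
Lemma fantope_inner_le_rank Y Z : fantope k Y -> fantope k Z -> inner Y Z <= k%:R.
Proof.
move=> FY; apply: fantope_inner_le => P PP; rewrite innerC; move: FY.
apply: fantope_inner_le => P' PP'.
have sP := orthoproj_symm PP; have sP' := orthoproj_symm PP'.
have := sqr_ge0 (frob (P - P')); rewrite sqr_frob; last exact: symmB.
rewrite !innerE (innerC P' P) (orthoproj_norm PP) (orthoproj_norm PP'); lra.
Qed.

Lemma sqr_frob_fantopeB Y Z : fantope k Y -> fantope k Z ->
  frob (Y - Z) ^+ 2 <= 2 * (k%:R - inner Y Z).
Proof.
move=> FY FZ; rewrite sqr_frob; last by apply: symmB; exact: fantope_symm.
have := fantope_inner_le_rank FY FY; have := fantope_inner_le_rank FZ FZ.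
rewrite !innerE (innerC Z Y); lra.
Qed.

(** All elements of [orthoproj] have squared norm [k], so among them a smaller distance to [Y] means
    a larger inner product with [Y]. *)
Lemma projection_inner_max (Y P W : 'M[R]_n) : symm Y ->
  is_projection (@orthoproj R n k) Y P -> orthoproj k W -> inner Y W <= inner Y P.
Proof.
move=> sY [PP minP] PW; have sP := orthoproj_symm PP.
have sW := orthoproj_symm PW.
have := minP _ PW; rewrite -(ler_pXn2r (ltn0Sn 1)) ?nnegrE ?frob_ge0//.
rewrite !sqr_frob; [|exact: symmB..].
rewrite !innerE (innerC P Y) (innerC W Y).
rewrite (orthoproj_norm PP) (orthoproj_norm PW).
lra.
Qed.

End Fantope.

(** * Orthonormal eigenbases and the eigengap inequality *)

Section Eigenbasis.
Variables (R : realType) (n : nat).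
Implicit Types A B Z U : 'M[R]_n.

Definition eigenbasis A U (d : 'rV[R]_n) :=
  U^T *m U = 1%:M /\ A *m U = U *m diag_mx d.

Lemma eigenbasisD A B U d e :
  eigenbasis A U d -> eigenbasis B U e -> eigenbasis (A + B) U (d + e).
Proof.
move=> [UU AU] [_ BU]; split=> //; rewrite mulmxDl AU BU -mulmxDr.
by congr (_ *m _); rewrite linearD.
Qed.

Lemma eigenbasisZ a A U d : eigenbasis A U d -> eigenbasis (a *: A) U (a *: d).
Proof.
move=> [UU AU]; split=> //; rewrite -scalemxAl AU scalemxAr.
by congr (_ *m _); rewrite linearZ.
Qed.

Lemma inner_eigenbasis A U d Z : eigenbasis A U d ->
  inner A Z = \sum_i d 0 i * (U^T *m Z *m U) i i.
Proof.
move=> [UU AU]; rewrite /inner -[A]mulmx1 -(mulmx1C UU) mulmxA AU -!mulmxA.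
rewrite mxtrace_mulC -!mulmxA /mxtrace; apply: eq_bigr => i _.
by rewrite mul_diag_mx mxE !mulmxA.
Qed.

Lemma diag_entry_conj U Z i :
  (U^T *m Z *m U) i i = inner (col i U *m (col i U)^T) Z.
Proof.
rewrite /inner -[in RHS]mulmxA [RHS]mxtrace_mulC trace_mx11 tr_col -!row_mul.
by rewrite [in RHS]colE mulmxA -colE [RHS]mxE [RHS]mxE.
Qed.

Lemma orthogonal_col_tr U i : U^T *m U = 1%:M ->
  \tr (col i U *m (col i U)^T) = 1.
Proof.
rewrite mxtrace_mulC trace_mx11 => /matrixP/(_ i i); rewrite !mxE eqxx mulr1n => <-.
by apply: eq_bigr => j _; rewrite !mxE.
Qed.

Lemma sum_ltn_ord m k : (k <= m)%N -> \sum_(i < m) (i < k)%N%:R = k%:R :> R.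
Proof.
move=> km; rewrite (eq_bigr (fun i : 'I_m => if (i < k)%N then 1 else 0)) => [|i _].
  by rewrite -big_mkcond -(big_ord_widen _ (fun=> 1)) // sumr_const card_ord.
by case: ifP.
Qed.

Variables (k : nat) (kn : (k <= n)%N).

(** For orthogonal [U], the orthogonal projection onto the span of its first [k] columns. *)
Definition topproj U := U *m pid_mx k *m U^T.

Lemma topprojE U : topproj U = (U *m pid_mx k) *m (U *m pid_mx k : 'M[R]_(n, k))^T.
Proof.
rewrite /topproj trmx_mul tr_pid_mx mulmxA -[U *m _ *m pid_mx k]mulmxA.
by rewrite mul_pid_mx !minnn.
Qed.

Lemma orthoproj_topproj U : U^T *m U = 1%:M -> orthoproj k (topproj U).
Proof.
move=> UU; exists (U *m pid_mx k); split; last exact: topprojE.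
rewrite trmx_mul tr_pid_mx mulmxA -[_ *m U^T *m U]mulmxA UU mulmx1 mul_pid_mx.
by rewrite minnn (minn_idPr kn) pid_mx_1.
Qed.

Lemma topproj_eigenbasis U : U^T *m U = 1%:M ->
  eigenbasis (topproj U) U (\row_i (i < k)%N%:R).
Proof.
move=> UU; split=> //; rewrite /topproj -!mulmxA UU mulmx1; congr (_ *m _).
by apply/matrixP => i j; rewrite !mxE -val_eqE; case: eqP => /= _; rewrite ?mulr1n.
Qed.

(** In the basis [U], the diagonal of [Z] has entries between 0 and 1 that sum to [k]. Whatever mass
    the first [k] entries lack sits in the other ones, and each unit so displaced costs at least
    [a - b]. *)
Lemma eigengap_inner A U d (a b : R) Z : eigenbasis A U d ->
  (forall i : 'I_n, (i < k)%N -> a <= d 0 i) ->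
  (forall i : 'I_n, (k <= i)%N -> d 0 i <= b) -> fantope k Z ->
  (a - b) * (k%:R - inner (topproj U) Z) <= inner A (topproj U - Z).
Proof.
move=> AUd ka kb FZ; have [UU _] := AUd.
have PUd := topproj_eigenbasis UU.
pose z i := (U^T *m Z *m U) i i.
have z01 i : 0 <= z i <= 1.
  rewrite /z diag_entry_conj; have := fantope_quad (col i U) FZ.
  by rewrite orthogonal_col_tr.
have sumz : \sum_i z i = k%:R.
  rewrite -(fantope_tr FZ) -[Z in RHS]mul1mx -(mulmx1C UU) -mulmxA.
  by rewrite [RHS]mxtrace_mulC.
have projE i : (U^T *m (topproj U - Z) *m U) i i = (i < k)%N%:R - z i.
  have PU : U^T *m topproj U *m U = pid_mx k.
    by rewrite /topproj -!mulmxA UU mulmx1 mulmxA UU mul1mx.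
  by rewrite mulmxBr mulmxBl PU mxE [X in X + _]mxE eqxx [X in _ + X]mxE.
(* The two diagonals have equal sums, so this multiple of their difference can be added for free;
   the inequality then holds entry by entry. *)
have sum0 : \sum_(i < n) b * ((i < k)%N%:R - z i) = 0.
  by rewrite -mulr_sumr sumrB sum_ltn_ord// sumz subrr mulr0.
rewrite (inner_eigenbasis _ AUd) (inner_eigenbasis _ PUd).
rewrite -[in leLHS](sum_ltn_ord kn) -sumrB mulr_sumr.
rewrite -[leLHS]addr0 -[X in _ + X <= _]sum0 -big_split /=; apply: ler_sum => i _.
rewrite projE mxE -/(z i); case: (ltnP i k) => ik /=.
  by have := ka i ik; have /andP[] := z01 i; nra.
by have := kb i ik; have /andP[] := z01 i; nra.
Qed.

End Eigenbasis.

(** * Weyl's inequality for the Frobenius norm *)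

Section Weyl.
Variables (R : realType) (n : nat).
Implicit Types A B U W : 'M[R]_n.

(* These are only [n - 1] homogeneous linear equations in [v]. *)
Lemma exists_common_vector U W (j : 'I_n) : exists v : 'cV[R]_n,
  [/\ v != 0, forall i : 'I_n, (i < j)%N -> (W^T *m v) i 0 = 0
    & forall i : 'I_n, (j < i)%N -> (U^T *m v) i 0 = 0].
Proof.
pose M := \matrix_(c, r) (if (r < j)%N then W c r else
                          if (j < r)%N then U c r else 0).
have /eqP/det0P[v v0 vM] : \det M = 0.
  rewrite (expand_det_col _ j) big1// => i _.
  by rewrite mxE ltnn mul0r.
have colE0 (V : 'M[R]_n) i : (forall c, M c i = V c i) -> (V^T *m v^T) i 0 = 0.
  move=> MV; have vMi : (v *m M) 0 i = 0 by rewrite vM mxE.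
  rewrite -[RHS]vMi [LHS]mxE [RHS]mxE; apply: eq_bigr => c _.
  by rewrite MV !mxE mulrC.
exists v^T; split.
- by apply: contra v0 => /eqP/(congr1 trmx); rewrite trmxK trmx0 => ->.
- by move=> i ij; apply: colE0 => c; rewrite mxE ij.
- by move=> i ji; apply: colE0 => c; rewrite mxE ji ltnNge ltnW.
Qed.

Lemma eigenbasis_quad A U d (v : 'cV[R]_n) : eigenbasis A U d ->
  inner A (v *m v^T) = \sum_i d 0 i * (U^T *m v) i 0 ^+ 2.
Proof.
move=> AUd; rewrite (inner_eigenbasis _ AUd); apply: eq_bigr => i _.
rewrite mulmxA -mulmxA -[v^T *m U]trmxK trmx_mul trmxK mxE big_ord1.
by rewrite expr2; congr (_ * (_ * _)); rewrite mxE.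
Qed.

Lemma orthogonal_quad U (v : 'cV[R]_n) : U^T *m U = 1%:M ->
  \tr (v *m v^T) = \sum_i (U^T *m v) i 0 ^+ 2.
Proof.
move=> UU; rewrite -[v *m v^T]mul1mx -/(inner _ _).
rewrite (@eigenbasis_quad _ U (const_mx 1)).
  by apply: eq_bigr => i _; rewrite mxE mul1r.
by split=> //; rewrite mul1mx diag_const_mx mulmx1.
Qed.

Lemma frob_col_mul_tr (v : 'cV[R]_n) : frob (v *m v^T) = \tr (v *m v^T).
Proof.
have N0 := mxtrace_mul_tr_ge0 v.
apply/eqP; rewrite -(eqrXn2 (ltn0Sn 1))//; last exact: frob_ge0.
rewrite sqr_frob; last by rewrite /symm /= trmx_mul trmxK.
rewrite /inner mulmxA -(mulmxA v) [v^T *m v]mx11_scalar -trace_mx11.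
by rewrite mul_mx_scalar -scalemxAl mxtraceZ (mxtrace_mulC v^T) expr2.
Qed.

(** Some nonzero [v] lies both in the span of the columns of [U] up to [j] and in the span of those
    of [W] from [j] on. Its Rayleigh quotient is at least [a] for [A] and at most [c] for [B];
    Cauchy-Schwarz against [v *m v^T] bounds the difference. *)
Lemma weyl_inequality A B U W d e (j : 'I_n) (a c : R) :
  symm A -> symm B -> eigenbasis A U d -> eigenbasis B W e ->
  (forall i : 'I_n, (i <= j)%N -> a <= d 0 i) ->
  (forall i : 'I_n, (j <= i)%N -> e 0 i <= c) ->
  a - c <= frob (A - B).
Proof.
move=> sA sB AUd BWe ad ec; have [UU _] := AUd; have [WW _] := BWe.
have [v [v0 Wv Uv]] := exists_common_vector U W j.
set N := \tr (v *m v^T).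
have N0 : 0 < N.
  rewrite /N mxtrace_mul_tr; under eq_bigr do rewrite big_ord1.
  exact: col_norm_gt0.
have leA : a * N <= inner A (v *m v^T).
  rewrite (eigenbasis_quad _ AUd) /N (orthogonal_quad _ UU) mulr_sumr.
  apply: ler_sum => i _; have [ij|ji] := leqP i j.
    by rewrite ler_wpM2r ?sqr_ge0 ?ad.
  by rewrite Uv// expr0n !mulr0.
have leB : inner B (v *m v^T) <= c * N.
  rewrite (eigenbasis_quad _ BWe) /N (orthogonal_quad _ WW) mulr_sumr.
  apply: ler_sum => i _; have [ij|ji] := leqP j i.
    by rewrite ler_wpM2r ?sqr_ge0 ?ec.
  by rewrite Wv// expr0n !mulr0.
have := @inner_le_frob _ _ (A - B) (v *m v^T) (symmB sA sB).
rewrite frob_col_mul_tr -/N innerDl innerNl => /(_ _) le_frob.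
rewrite -(ler_pM2r N0) mulrBl; apply: le_trans (le_frob _).
  by rewrite lerB.
by rewrite /symm /= trmx_mul trmxK.
Qed.

End Weyl.

(** * Ordered eigenvalues and leading eigenvectors *)

Lemma col_mulmx (R : pzSemiRingType) m n p (A : 'M[R]_(m, n)) (B : 'M[R]_(n, p)) j :
  col j (A *m B) = A *m col j B.
Proof. by rewrite !colE mulmxA. Qed.

Section Leading.
Variables (R : realType) (n : nat).
Implicit Types Y U W Z P : 'M[R]_n.

Lemma size_eigvals Y : symm Y -> size (eigvals Y) = n.
Proof.
move=> sY; have [_ cY] := eigvalsP sY; apply/eqP; rewrite -eqSS.
by rewrite -(size_char_poly Y) [in X in _ == X]cY size_prod_XsubC.
Qed.

Lemma lambda_nonincreasing Y i j : symm Y -> (0 < i)%N -> (i <= j)%N ->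
  (j <= n)%N -> lambda j Y <= lambda i Y.
Proof.
move=> sY i0 ij jn; have [sortedY _] := eigvalsP sY.
have ge_trans : transitive (fun x y : R => y <= x).
  by move=> y x z /[swap]; exact: le_trans.
apply: (sorted_leq_nth ge_trans (fun x => lexx x) 0 sortedY).
- by rewrite inE size_eigvals//; lia.
- by rewrite inE size_eigvals//; lia.
- by lia.
Qed.

Lemma symm_eigenbasis Y : symm Y ->
  exists U, eigenbasis Y U (\row_(i < n) lambda i.+1 Y).
Proof.
move=> sY; have [_ cY] := eigvalsP sY.
by have [U [UU YU]] := real_spectral sY cY; exists U; split.
Qed.

(** Increasing order puts the bottom eigenspaces in the first columns, so that after negation
    [topproj] selects them. *)
Lemma symm_eigenbasis_rev Y : symm Y ->
  exists U, eigenbasis Y U (\row_(i < n) lambda (n - i) Y).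
Proof.
move=> sY; have [_ cY] := eigvalsP sY.
have cY' : char_poly Y = \prod_(a <- rev (eigvals Y)) ('X - a%:P).
  by rewrite cY; apply: perm_big; rewrite perm_sym perm_rev.
have [U [UU YU]] := real_spectral sY cY'; exists U; split=> //.
rewrite YU; congr (_ *m diag_mx _); apply/rowP => i; rewrite !mxE /lambda.
by rewrite nth_rev ?size_eigvals// subnS.
Qed.

Variables (k : nat) (kn : (k <= n)%N).

Lemma eigenbasis_leading Y U : eigenbasis Y U (\row_(i < n) lambda i.+1 Y) ->
  leading_eigenvectors Y (U *m pid_mx k : 'M[R]_(n, k)).
Proof.
move=> [UU YU]; split.
  rewrite trmx_mul tr_pid_mx mulmxA -[_ *m U^T *m U]mulmxA UU mulmx1 mul_pid_mx.
  by rewrite minnn (minn_idPr kn) pid_mx_1.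
move=> j; rewrite -!col_mulmx !mulmxA YU -mulmxA.
rewrite [X in _ *m X](_ : _ = pid_mx k *m diag_mx (\row_i lambda i.+1 Y)).
  apply/colP => i; rewrite mulmxA mul_mx_diag !mxE mulrC; congr (_ * _).
apply/matrixP => i l; rewrite mul_mx_diag mul_diag_mx !mxE mulrC.
by case: eqP => [->|]; rewrite ?mul0r.
Qed.

(** The value depends on [Y] and [k] alone, so all choices of leading eigenvectors attain the same
    inner product. *)
Lemma leading_eigenvectors_inner Y (Q : 'M[R]_(n, k)) :
  leading_eigenvectors Y Q ->
  inner Y (Q *m Q^T) = \sum_(j < k) lambda j.+1 Y.
Proof.
move=> [QQ YQ].
have -> : inner Y (Q *m Q^T) = \tr (Q *m diag_mx (\row_j lambda j.+1 Y) *m Q^T).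
  rewrite /inner mulmxA; congr (\tr (_ *m _)).
  apply/matrixP => i j; have /colP/(_ i) := YQ j.
  by rewrite -col_mulmx mxE => ->; rewrite mul_mx_diag !mxE mulrC.
rewrite mxtrace_mulC mulmxA QQ mul1mx mxtrace_diag.
by apply: eq_bigr => j _; rewrite mxE.
Qed.

End Leading.

(** * Uniqueness of the maximizer under an eigengap *)

Section TopGap.
Variables (R : realType) (n k : nat) (kn : (k <= n)%N).
Variables (A U : 'M[R]_n) (d : 'rV[R]_n) (a b : R).
Hypotheses (AUd : eigenbasis A U d) (ba : b < a).
Hypothesis ka : forall i : 'I_n, (i < k)%N -> a <= d 0 i.
Hypothesis kb : forall i : 'I_n, (k <= i)%N -> d 0 i <= b.

(** Maximality makes the right-hand side of [eigengap_inner] nonpositive, so [inner (topproj k U) Z]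
    is at least [k], and [sqr_frob_fantopeB] then bounds the distance by zero. *)
Lemma eigengap_maximizer Z : fantope k Z ->
  (forall P, orthoproj k P -> inner A P <= inner A Z) -> Z = topproj k U.
Proof.
move=> FZ maxZ; have [UU _] := AUd.
have PU := orthoproj_topproj kn UU; have FU := fantope_orthoproj PU.
have := eigengap_inner kn AUd ka kb FZ; rewrite innerDr innerNr.
move=> /le_trans/(_ (_ : _ <= 0)); rewrite subr_le0 => /(_ (maxZ _ PU)).
rewrite pmulr_rle0 ?subr_gt0// => gap0; apply/esym/eqP; rewrite -subr_eq0.
apply/eqP/frob_eq0/eqP; rewrite -sqrf_eq0 eq_le sqr_ge0 andbT.
by apply: le_trans (sqr_frob_fantopeB FU FZ) _; rewrite pmulr_rle0.
Qed.

End TopGap.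

(** * First-order conditions and the descent lemma *)

Section Smooth.
Variables (R : realType) (n : nat) (f : 'M[R]_n -> R).
Implicit Types G H X Z : 'M[R]_n.

(** The first-order conditions below divide by [s] and let [eps] shrink, so one step length for each
    [eps] is enough; [s <= 1] keeps the point on the segment. *)
Lemma gradient_expansion G X H (eps : R) : is_gradient f X G -> symm H ->
  0 < eps -> exists s, [/\ 0 < s, s <= 1 &
    `|f (X + s *: H) - f X - s * inner G H| <= eps * s].
Proof.
move=> [_ fG] sH eps0; have [H0|H0] := eqVneq (frob H) 0.
  exists 1; split=> //; rewrite (frob_eq0 H0) scaler0 addr0 subrr.
  by rewrite /inner mulmx0 mxtrace0 mulr0 subr0 normr0 mulr1 ltW.
have Hgt0 : 0 < frob H by rewrite lt_def H0 frob_ge0.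
have /cvgr0Pnorm_le/(_ (eps / frob H) (divr_gt0 eps0 Hgt0)) := fG.
rewrite near_withinE near_withinE => /nbhs_ballP[r /= r0 ballP].
(* Balls of matrices are entrywise, hence one bound on [s] per entry; the [1 +] keeps the
   denominators positive. *)
have /filter_ex[s [s0 s1 sr]] : \forall s \near (0 : R)^'+,
    [/\ 0 < s, s <= 1 & forall ij : 'I_n * 'I_n, s < r / (1 + `|H ij.1 ij.2|)].
  near=> s; split.
  - by near: s; exact: nbhs_right_gt.
  - by near: s; exact: nbhs_right_le.
  - near: s; apply: filter_forall => ij; apply: nbhs_right_lt.
    by rewrite divr_gt0// ltr_wpDr.
exists s; split=> //; have sHE := frobZ H (ltW s0).
have := ballP (s *: H); rewrite sHE => /(_ _ _ _) le_eps.
suff : `|(f (X + s *: H) - f X - inner G (s *: H)) / (s * frob H)| <= eps / frob H.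
  have sH0 : 0 < s * frob H by rewrite mulr_gt0.
  rewrite innerZr normf_div (gtr0_norm sH0) ler_pdivrMr// => /le_trans; apply.
  by rewrite mulrCA -mulrA mulVf// mulr1 mulrC.
apply: le_eps.
- split=> // i j; rewrite !mxE -ball_normE /= sub0r normrN normrM gtr0_norm//.
  have := sr (i, j); rewrite /= ltr_pdivlMr ?ltr_wpDr//.
  by apply: le_lt_trans; rewrite ler_pM2l// lerDr.
- apply/eqP => /eqP; rewrite scaler_eq0 gt_eqF//= => /eqP HE.
  by move: H0; rewrite HE -(scale0r 0) frobZ// mul0r eqxx.
- exact: symmZ.
Unshelve. all: by end_near.
Qed.

Hypothesis convf : convex_function (@symm R n) f.

Lemma convex_segment X Z (s : R) : symm X -> symm Z -> 0 <= s -> s <= 1 ->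
  f (X + s *: (Z - X)) <= (1 - s) * f X + s * f Z.
Proof.
move=> sX sZ s0 s1.
have := @convf (Itv01 s0 s1) Z X; rewrite !inE => /(_ sZ sX).
rewrite convRE /conv /= [leRHS]addrC; apply: le_trans.
rewrite le_eqVlt; apply/orP; left; apply/eqP; congr f.
by rewrite scalerBl scale1r scalerBr addrCA.
Qed.

Lemma convex_gradient_le G X Z : symm X -> symm Z -> is_gradient f X G ->
  f X + inner G (Z - X) <= f Z.
Proof.
move=> sX sZ fG; apply/ler_addgt0Pr => eps eps0.
have [s [s0 s1]] := gradient_expansion fG (symmB sZ sX) eps0.
have := convex_segment sX sZ (ltW s0) s1.
rewrite ler_norml => le_f /andP[ge_f _].
by rewrite -(ler_pM2l s0); lra.
Qed.

Lemma minimizer_gradient_ge0 G X Z : symm X -> symm Z -> is_gradient f X G ->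
  (forall s, 0 <= s -> s <= 1 -> f X <= f (X + s *: (Z - X))) ->
  0 <= inner G (Z - X).
Proof.
move=> sX sZ fG minX; apply/ler_addgt0Pr => eps eps0.
have [s [s0 s1]] := gradient_expansion fG (symmB sZ sX) eps0.
have := minX s (ltW s0) s1; rewrite ler_norml => le_f /andP[_ le_s].
by rewrite -(ler_pM2l s0); lra.
Qed.

Variables (gradf : 'M[R]_n -> 'M[R]_n) (beta : R).
Hypothesis gradfP : forall X, symm X -> is_gradient f X (gradf X).
Hypothesis beta0 : 0 < beta.
Hypothesis smoothf : forall X Z, symm X -> symm Z ->
  frob (gradf X - gradf Z) <= beta * frob (X - Z).

Lemma symm_gradf X : symm X -> symm (gradf X).
Proof. by move=> /gradfP[]. Qed.

(** Convexity at the new point bounds each increment by [h] times the slope there, and smoothness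
    bounds that slope by the one at [X] plus a multiple of the step number. Summing the step numbers
    gives [m (m + 1) / 2]. *)
Lemma descent_steps X H (h : R) (m : nat) : symm X -> symm H -> 0 <= h ->
  f (X + (m%:R * h) *: H) <= f X + m%:R * h * inner (gradf X) H +
    beta * frob H ^+ 2 * h ^+ 2 * (m%:R * (m%:R + 1) / 2).
Proof.
move=> sX sH h0; elim: m => [|m IHm].
  by rewrite !mul0r scale0r addr0 mulr0 !addr0.
set Y := X + (m%:R * h) *: H in IHm.
set Z := X + (m.+1%:R * h) *: H.
have sZ : symm Z by apply/symmD/symmZ.
have sY : symm Y by apply/symmD/symmZ.
have YZ : Y - Z = - h *: H.
  rewrite /Y /Z opprD addrACA subrr add0r -scalerBl; congr (_ *: _).
  by rewrite -natr1; ring.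
have := convex_gradient_le sZ sY (gradfP sZ); rewrite YZ innerZr => leZ.
have : inner (gradf Z - gradf X) H <= beta * (m.+1%:R * h * frob H) * frob H.
  apply: le_trans (inner_le_frob _ sH) _.
    by apply: symmB; exact: symm_gradf.
  rewrite ler_wpM2r ?frob_ge0 //.
  apply: le_trans (smoothf sZ sX) _.
  by rewrite /Z addrC addKr frobZ ?mulr_ge0.
rewrite innerDl innerNl => /(ler_wpM2l h0).
move: IHm leZ; rewrite -[m.+1%:R]natr1.
move: (f Z) (f Y) (f X) (inner _ _) (inner _ _) (frob H) (m%:R) => *.
lra.
Qed.

(* Convexity bounds each of the [N] increments along the segment by the
   gradient at the far end, which gives the descent lemma up to [1 / N]. *)
Lemma descent X Z : symm X -> symm Z ->
  f Z <= f X + inner (gradf X) (Z - X) + beta / 2 * frob (Z - X) ^+ 2.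
Proof.
move=> sX sZ; apply/ler_addgt0Pr => eps eps0.
set c := beta / 2 * frob (Z - X) ^+ 2.
have c0 : 0 <= c by rewrite mulr_ge0 ?sqr_ge0// divr_ge0// ltW.
(* With [h = 1 / N], the quadratic term of [descent_steps] equals [c + c / N]. *)
have [N [N0 cN]] : exists N : nat, 0 < N%:R :> R /\ c / N%:R <= eps.
  have N0 : 0 < (Num.bound (c / eps)).+1%:R :> R by rewrite ltr0n.
  exists (Num.bound (c / eps)).+1; split=> //.
  rewrite ler_pdivrMr// mulrC -ler_pdivrMr//.
  have ceps0 : 0 <= c / eps by rewrite divr_ge0// ltW.
  by apply: ltW; apply: lt_le_trans (archi_boundP ceps0) _; rewrite ler_nat.
have := @descent_steps X (Z - X) N%:R^-1 N sX (symmB sZ sX).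
rewrite invr_ge0 (ltW N0) mulfV ?gt_eqF// scale1r mul1r subrKC => /(_ isT).
move=> /le_trans; apply; rewrite -!addrA !lerD2l.
apply: le_trans (_ : c + c / N%:R <= _); last by rewrite lerD2l.
rewrite le_eqVlt; apply/orP; left; apply/eqP; rewrite /c.
by field; rewrite gt_eqF.
Qed.

End Smooth.

(** * Structure of the minimizer and analysis of one gradient step *)

Section Minimizer.
Variables (R : realType) (n k : nat) (f : 'M[R]_n -> R).
Variables (gradf : 'M[R]_n -> 'M[R]_n) (beta delta : R) (Xs : 'M[R]_n).
Hypotheses (k0 : (0 < k)%N) (kn : (k < n)%N).
Hypothesis convf : convex_function (@symm R n) f.
Hypothesis gradfP : forall X, symm X -> is_gradient f X (gradf X).
Hypothesis beta0 : 0 < beta.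
Hypothesis smoothf : forall X Z, symm X -> symm Z ->
  frob (gradf X - gradf Z) <= beta * frob (X - Z).
Hypotheses (FXs : fantope k Xs) (minXs : forall Z, fantope k Z -> f Xs <= f Z).
Hypothesis delta0 : 0 < delta.
Hypothesis gap : delta <= lambda (n - k) (gradf Xs) - lambda (n - k + 1) (gradf Xs).

Let kn' : (k <= n)%N := ltnW kn.
Let sXs : symm Xs := fantope_symm FXs.
Let sGs : symm (gradf Xs) := symm_gradf gradfP sXs.

(** First-order optimality makes [Xs] a maximizer of the inner product with [- gradf Xs], and the
    gap leaves only one. *)
Lemma minimizer_topproj : exists U d,
  [/\ eigenbasis (- gradf Xs) U d, Xs = topproj k U,
    forall i : 'I_n, (i < k)%N -> - lambda (n - k + 1) (gradf Xs) <= d 0 i &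
    forall i : 'I_n, (k <= i)%N -> d 0 i <= - lambda (n - k) (gradf Xs)].
Proof.
have [U GU] := symm_eigenbasis_rev sGs.
have {GU} := eigenbasisZ (-1) GU; rewrite scaleN1r; set d := -1 *: _ => GU.
have ka (i : 'I_n) : (i < k)%N -> - lambda (n - k + 1) (gradf Xs) <= d 0 i.
  move=> ik; rewrite /d !mxE mulN1r lerN2 lambda_nonincreasing//; lia.
have kb (i : 'I_n) : (k <= i)%N -> d 0 i <= - lambda (n - k) (gradf Xs).
  move=> ki; have := ltn_ord i.
  by rewrite /d !mxE mulN1r lerN2 => ?; rewrite lambda_nonincreasing//; lia.
exists U, d; split=> //; apply: (eigengap_maximizer kn' GU _ ka kb) => //.
  by rewrite ltrN2 -subr_gt0; exact: lt_le_trans gap.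
move=> P PP; have FP := fantope_orthoproj PP.
rewrite !innerNl lerN2 -subr_ge0 -innerNr -innerDr.
apply: (@minimizer_gradient_ge0 _ _ f) => //; first exact: orthoproj_symm PP.
  exact: gradfP.
by move=> s s0 s1; apply/minXs/conv_hull_segment.
Qed.

(** By convexity the increase is at least the gradient term, which the eigengap bounds below by
    [delta * (k%:R - inner Xs Z)]; that controls the squared distance. *)
Lemma quadratic_growth Z : fantope k Z ->
  delta / 2 * frob (Z - Xs) ^+ 2 <= f Z - f Xs.
Proof.
move=> FZ; have [U [d [GU XsU ka kb]]] := minimizer_topproj.
have := eigengap_inner kn' GU ka kb FZ; rewrite -XsU.
have := sqr_frob_fantopeB FXs FZ; rewrite frob_distC.
have := convex_gradient_le convf sXs (fantope_symm FZ) (gradfP sXs).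
rewrite !innerE; move: gap (sqr_ge0 (frob (Z - Xs))) delta0.
move: (frob _ ^+ 2) (k%:R - _) (lambda _ _) (lambda _ _) => x y l m *.
nra.
Qed.

Variable X : 'M[R]_n.
Hypotheses (FX : fantope k X) (nearX : frob (X - Xs) <= delta / (4 * beta)).
Let sX : symm X := fantope_symm FX.
Let Y := X - beta^-1 *: gradf X.

Lemma symm_gradient_step : symm Y.
Proof. by apply/symmB/symmZ/(symm_gradf gradfP). Qed.

(** The same step taken from [Xs] has gap at least [1 + delta / beta]: the projection [Xs]
    contributes 1 and the gradient the rest. Each of the two eigenvalues moves by at most
    [delta / beta / 2]. *)
Lemma gradient_step_gap : 1 <= lambda k Y - lambda k.+1 Y.
Proof.
have sY := symm_gradient_step.
pose Ys := Xs - beta^-1 *: gradf Xs.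
have sYs : symm Ys by apply/symmB/symmZ.
(* Half of this bound comes from [X - Xs], the other half from the gradients, by smoothness. *)
have YYs : frob (Y - Ys) <= delta / beta / 2.
  have -> : Y - Ys = (X - Xs) + beta^-1 *: (gradf Xs - gradf X).
    rewrite /Y /Ys scalerBr opprD opprK addrACA; congr (_ + _).
    exact: addrC.
  have sG := symm_gradf gradfP sX.
  apply: le_trans (frob_triangle (symmB _ _) (symmZ _ (symmB _ _))) _ => //.
  rewrite frobZ ?invr_ge0 ?(ltW beta0)//.
  have : beta^-1 * frob (gradf Xs - gradf X) <= frob (X - Xs).
    by rewrite mulrC ler_pdivrMr// mulrC frob_distC smoothf.
  have -> : delta / beta / 2 = 2 * (delta / (4 * beta)).
    by field; rewrite gt_eqF.
  by move: nearX; move: (delta / _) => q; lra.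
have [U [d [GU XsU ka kb]]] := minimizer_topproj.
have YsU : eigenbasis Ys U ((\row_i (i < k)%N%:R) + beta^-1 *: d).
  rewrite /Ys -scalerN; apply: eigenbasisD (eigenbasisZ _ GU).
  by rewrite XsU; apply: topproj_eigenbasis; case: GU.
have [W YW] := symm_eigenbasis sY.
have le1 : 1 - beta^-1 * lambda (n - k + 1) (gradf Xs) - lambda k Y <=
    frob (Ys - Y).
  have k1n : (k.-1 < n)%N by lia.
  apply: (weyl_inequality sYs sY YsU YW (j := Ordinal k1n)) => i /= ik.
    have {}ik : (i < k)%N by lia.
    by rewrite !mxE ik lerD2l -mulrN ler_pM2l ?invr_gt0 ?ka.
  by rewrite mxE lambda_nonincreasing//; lia.
have le2 : lambda k.+1 Y - - (beta^-1 * lambda (n - k) (gradf Xs)) <=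
    frob (Y - Ys).
  apply: (weyl_inequality sY sYs YW YsU (j := Ordinal kn)) => i /= ik.
    by rewrite mxE lambda_nonincreasing//; lia.
  by rewrite !mxE ltnNge ik add0r -mulrN ler_pM2l ?invr_gt0 ?kb.
have : delta / beta <= beta^-1 * lambda (n - k) (gradf Xs)
                       - beta^-1 * lambda (n - k + 1) (gradf Xs).
  by rewrite -mulrBr mulrC ler_pM2l ?invr_gt0.
move: le1 le2 YYs; rewrite (frob_distC Ys); lra.
Qed.

Variable Xp : 'M[R]_n.
Hypothesis projXp : is_projection (@orthoproj R n k) Y Xp.
Let PXp : orthoproj k Xp := projXp.1.
Let FXp : fantope k Xp := fantope_orthoproj PXp.

Lemma projection_eigengap : exists U,
  [/\ Xp = topproj k U, eigenbasis Y U (\row_(i < n) lambda i.+1 Y),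
    forall i : 'I_n, (i < k)%N -> lambda k Y <= (\row_(i < n) lambda i.+1 Y) 0 i &
    forall i : 'I_n, (k <= i)%N -> (\row_(i < n) lambda i.+1 Y) 0 i <= lambda k.+1 Y].
Proof.
have sY := symm_gradient_step.
have [U YU] := symm_eigenbasis sY.
have ka (i : 'I_n) : (i < k)%N -> lambda k Y <= (\row_(i < n) lambda i.+1 Y) 0 i.
  by move=> ik; rewrite mxE lambda_nonincreasing.
have kb (i : 'I_n) : (k <= i)%N -> (\row_(i < n) lambda i.+1 Y) 0 i <= lambda k.+1 Y.
  by move=> ik; rewrite mxE lambda_nonincreasing.
exists U; split=> //; apply: (eigengap_maximizer kn' YU _ ka kb) => //.
  by have := gradient_step_gap; lra.
by move=> P; exact: projection_inner_max.
Qed.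

(** [Xp] itself arises from leading eigenvectors, so [Q *m Q^T] attains the same maximum, and the
    gap makes the maximizer unique. *)
Lemma projection_leading (Q : 'M[R]_(n, k)) :
  leading_eigenvectors Y Q -> Xp = Q *m Q^T.
Proof.
move=> YQ; have [U [XpU YU ka kb]] := projection_eigengap.
have lt_gap : lambda k.+1 Y < lambda k Y by have := gradient_step_gap; lra.
have PQ : orthoproj k (Q *m Q^T) by exists Q; case: YQ.
rewrite XpU; apply/esym/(eigengap_maximizer kn' YU lt_gap ka kb).
  exact: fantope_orthoproj.
move=> P PP; apply: le_trans (projection_inner_max symm_gradient_step projXp PP) _.
rewrite XpU topprojE (leading_eigenvectors_inner YQ).
by rewrite (leading_eigenvectors_inner (eigenbasis_leading kn' YU)).
Qed.

(* Since the eigengap is at least [1], the projection onto the nonconvex set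
   is also the projection onto its convex hull. *)
Lemma projection_fantope Z : fantope k Z -> inner (Y - Xp) (Z - Xp) <= 0.
Proof.
move=> FZ; have [U [XpU YU ka kb]] := projection_eigengap.
(* A gap of at least 1 gives [inner Y (Xp - Z) >= k%:R - inner Xp Z], and the right-hand side is
   [inner Xp (Xp - Z)]. *)
have := eigengap_inner kn' YU ka kb FZ; rewrite -XpU.
have := gradient_step_gap; have := fantope_inner_le_rank FXp FZ.
rewrite !innerE (orthoproj_norm PXp).
by move: (inner _ _) (k%:R) (inner _ _) (inner _ _) => *; nra.
Qed.

(** Three-point inequality: the descent lemma from [X] to [Xp] is added to [beta] times the
    variational inequality [projection_fantope], and the quadratic terms combine into a difference
    of squared distances. *)
Lemma projected_gradient_le Z : fantope k Z -> f Xp <= f X +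
  inner (gradf X) (Z - X) + beta / 2 * (frob (X - Z) ^+ 2 - frob (Z - Xp) ^+ 2).
Proof.
move=> FZ; have sZ := fantope_symm FZ; have sXp := orthoproj_symm PXp.
have := descent convf gradfP beta0 smoothf sX sXp.
have := projection_fantope FZ; rewrite -(pmulr_rle0 _ beta0).
have -> : beta * inner (Y - Xp) (Z - Xp) =
    beta * inner (X - Xp) (Z - Xp) - inner (gradf X) (Z - Xp).
  have -> : Y - Xp = (X - Xp) + - (beta^-1 *: gradf X) by rewrite addrAC.
  by rewrite innerDl innerNl innerZl mulrDr mulrN mulVKf// gt_eqF.
rewrite !sqr_frob; [|exact: symmB..].
rewrite !innerE (innerC Xp X) (innerC Z X) (innerC Xp Z); lra.
Qed.

(** With [Z = Xs] in the three-point inequality, convexity and [f Xs <= f Xp] leave only the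
    difference of squared distances, which must be nonnegative. *)
Lemma projection_dist_le : frob (Xp - Xs) <= frob (X - Xs).
Proof.
have le_f := projected_gradient_le FXs; have ge_f := minXs FXp.
have convX := convex_gradient_le convf sX sXs (gradfP sX).
rewrite -(ler_pXn2r (ltn0Sn 1)) ?nnegrE ?frob_ge0// (frob_distC Xp).
rewrite -subr_ge0 -(pmulr_rge0 _ beta0); lra.
Qed.

(* Optimizing over [Z = X + s (Xs - X)] and bounding the distance to [Xs] by
   quadratic growth, at [s = min(1, delta / (2 beta))]. *)
Lemma projection_decrease : f Xp - f Xs <=
  (1 - Num.min 1 (delta / beta / 2) / 2) * (f X - f Xs).
Proof.
set s := Num.min 1 (delta / beta / 2).
have [s0 s1] : 0 <= s /\ s <= 1.
  by split; rewrite /s ?ge_min ?lexx// le_min ler01 !divr_ge0 ?ltW.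
have FZ := conv_hull_segment s0 s1 FX FXs.
have := projected_gradient_le FZ.
have -> : X + s *: (Xs - X) - X = s *: (Xs - X) by rewrite addrC addKr.
have -> : X - (X + s *: (Xs - X)) = s *: (X - Xs).
  by rewrite opprD addrA subrr add0r -scalerN opprB.
rewrite innerZr frobZ// exprMn => le_f.
have := quadratic_growth FX.
have := convex_gradient_le convf sX sXs (gradfP sX).
have : s * beta <= delta / 2.
  by rewrite -ler_pdivlMr// /s ge_min mulrAC lexx orbT.
have := sqr_ge0 (frob (X + s *: (Xs - X) - Xp)); have := sqr_ge0 (frob (X - Xs)).
move: le_f.
move: (frob (X - Xs) ^+ 2) (frob _ ^+ 2) (inner _ _) (f X) (f Xs) (f Xp).
move=> d2 e2 g fX fXs fXp le_f d20 e20 sb convX growth.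
have h1 : s * g <= s * (fXs - fX) by rewrite ler_wpM2l//; lra.
(* The choice of [s] and quadratic growth make the quadratic term cost at most half of the linear
   decrease, hence the factor [1 - s / 2]. *)
have h2 : beta / 2 * (s ^+ 2 * d2) <= s / 2 * (fX - fXs).
  have : s * d2 * (s * beta) <= s * d2 * (delta / 2) by rewrite ler_wpM2l// mulr_ge0.
  have : s * (delta / 2 * d2) <= s * (fX - fXs) by rewrite ler_wpM2l.
  lra.
have : 0 <= beta / 2 * e2 by rewrite mulr_ge0// divr_ge0// ltW.
lra.
Qed.

End Minimizer.

(** * Rate function and induction along the iterates *)

Unset Implicit Arguments.

Theorem theorem4 (R : realType) :
  exists rho : R -> R,
    (forall x : R, 0 < x -> 0 < rho x) /\
    rho =Theta_(0^'+) (fun x : R => x) /\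
    forall (n k : nat) (f : 'M[R]_n -> R) (gradf : 'M[R]_n -> 'M[R]_n)
           (beta delta : R) (Xs : 'M[R]_n) (X : nat -> 'M[R]_n),
      (1 <= k)%N -> (k < n)%N ->
      convex_function (@symm R n) f ->
      (forall A, symm A -> is_gradient f A (gradf A)) ->
      0 < beta ->
      (forall A B, symm A -> symm B ->
         frob (gradf A - gradf B) <= beta * frob (A - B)) ->
      fantope k Xs ->
      (forall Z, fantope k Z -> f Xs <= f Z) ->
      0 < delta ->
      lambda (n - k) (gradf Xs) - lambda (n - k + 1) (gradf Xs) >= delta ->
      fantope k (X 1%N) ->
      frob (X 1%N - Xs) <= delta / (4 * beta) ->
      (forall t : nat, (1 <= t)%N ->
         is_projection (@orthoproj R n k)
           (X t - beta^-1 *: gradf (X t)) (X t.+1)) ->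
      forall t : nat, (1 <= t)%N ->
        (\rank (X t.+1) = k /\
         (exists Q : 'M[R]_(n, k),
            leading_eigenvectors (X t - beta^-1 *: gradf (X t)) Q) /\
         (forall Q : 'M[R]_(n, k),
            leading_eigenvectors (X t - beta^-1 *: gradf (X t)) Q ->
            X t.+1 = Q *m Q^T)) /\
        f (X t) - f Xs <=
          (f (X 1%N) - f Xs) * expR (- rho (delta / beta) * (t%:R - 1)).
Proof.
(* This is half of the step length [s] of [projection_decrease], at [x = delta / beta]. *)
exists (fun x => Num.min 1 (x / 2) / 2); split=> [x x0|].
  by rewrite divr_gt0// lt_min ltr01 divr_gt0.
split.
  (* For [x <= 2] the rate is exactly [x / 4], so both constants are [4^-1]. *)
  rewrite eqThetaE qualifE; apply/asboolP; exists (4^-1, 4^-1) => /=.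
    by rewrite invr_gt0 ltr0n.
  near=> x; have x0 : 0 < x by near: x; exact: nbhs_right_gt.
  have x2 : x <= 2 by near: x; apply: nbhs_right_le; rewrite ltr0n.
  have -> : Num.min 1 (x / 2) = x / 2 by rewrite min_r// ler_pdivrMr// mul1r.
  by rewrite !ger0_norm; lra.
move=> n k f gradf beta delta Xs X k0 kn convf gradfP beta0 smoothf FXs minXs
  delta0 gap FX1 nearX1 projX.
have invX t : (1 <= t)%N -> fantope k (X t) /\ frob (X t - Xs) <= delta / (4 * beta).
  elim: t => // -[_ _ //|t IHt _]; have [FX nearX] := IHt isT.
  split; first by have [/fantope_orthoproj] := projX t.+1 isT.
  apply: le_trans (nearX).
  exact: (projection_dist_le k0 kn convf gradfP beta0 smoothf FXs minXs delta0 gap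
    FX nearX (projX t.+1 isT)).
move=> t t1; have [FX nearX] := invX t t1; split.
  split; first by have [/orthoproj_rank] := projX t t1.
  split; last first.
    exact: (projection_leading k0 kn gradfP beta0 smoothf FXs minXs delta0 gap
      FX nearX (projX t t1)).
  have [U YU] := symm_eigenbasis (symm_gradient_step beta gradfP FX).
  by eexists; exact: (eigenbasis_leading (ltnW kn) YU).
set r := Num.min 1 (delta / beta / 2) / 2.
case: t t1 {FX nearX} => // t _; rewrite -natr1 addrK.
elim: t => [|t IHt]; first by rewrite mulr0 expR0 mulr1.
have [FX nearX] := invX t.+1 isT.
have le_step := projection_decrease k0 kn convf gradfP beta0 smoothf FXs minXs delta0
  gap FX nearX (projX t.+1 isT).
apply: le_trans le_step _; rewrite -/r -[t.+1%:R]natr1 [- r * _]mulrDr mulr1.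
rewrite expRD mulrA [leRHS]mulrC.
(* The contraction factor is turned into an exponential by [1 - r <= expR (- r)], as the objective
   gap is nonnegative. *)
apply: le_trans (_ : expR (- r) * (f (X t.+1) - f Xs) <= _).
  by rewrite ler_wpM2r ?expR_ge1Dx// subr_ge0 minXs.
by rewrite ler_wpM2l ?expR_ge0.
Unshelve. all: by end_near.
Qed.
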